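(* Let $n\ge 2$ and let $S$ be a set of $n$ points in $\mathbb{R}^2$. Then the number of unordered pairs $\{p,q\}\subset S$ with $|p-q|=1$ and such that $\{p,q\}$ has rational angle is at most $n^{1+6/\sqrt{\log n}}$, where $\log$ denotes the natural logarithm.
   Context: Identify $\mathbb{R}^2$ with $\mathbb{C}$. A pair of distinct points $p,q$ has rational angle if the segment between them, viewed as the complex number $q-p=re^{\pi i\gamma}$ with $r>0$, has $\gamma\in\mathbb{Q}$; equivalently, the line through $p$ and $q$ makes an angle with the $x$-axis that is a rational multiple of $\pi$. *)

(* Defs.v *)
From HB Require Import structures.
From mathcomp Require Import all_boot all_order all_algebra.
From mathcomp Require Import all_classical all_reals all_analysis.
Set Implicit Arguments. Unset Strict Implicit. Unset Printing Implicit Defensive.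
Import Order.TTheory GRing.Theory Num.Theory.
Local Open Scope ring_scope.

Section Defs.
Variable R : realType.

(* {p,q} has rational angle: q - p = r e^{pi i gamma} with r > 0, gamma rational.
   (This forces p <> q.) *)
Definition rational_angle (p q : R * R) : Prop :=
  exists (r : R) (g : rat), 0 < r /\
    q.1 - p.1 = r * cos (pi * ratr g) /\ q.2 - p.2 = r * sin (pi * ratr g).

Definition unit_dist (p q : R * R) : Prop :=
  Num.sqrt ((q.1 - p.1) ^+ 2 + (q.2 - p.2) ^+ 2) = 1.

Definition good_pair (p q : R * R) : bool :=
  `[< unit_dist p q /\ rational_angle p q >].

(* Number of unordered pairs {p,q} of (distinct) elements of the duplicate-free
   list s with |p - q| = 1 and rational angle: pairs of indices i < j. *)
Definition count_good_pairs (s : seq (R * R)) : nat :=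
  \sum_(i < size s) \sum_(j < size s | (i < j)%N)
     (good_pair (nth (0%R : R, 0%R : R) s i) (nth (0%R : R, 0%R : R) s j) : nat).

End Defs.

(* Main.v *)
Require Import Defs.
From HB Require Import structures.
From mathcomp Require Import all_boot all_order all_algebra.
From mathcomp Require Import separable algC cyclotomic cyclic complex.
From mathcomp Require Import all_classical all_reals all_analysis.
From mathcomp Require Import zify ring lra.
Import Order.TTheory GRing.Theory Num.Theory.
Local Open Scope ring_scope.
Set Implicit Arguments.
Unset Strict Implicit.
Unset Printing Implicit Defensive.

(** In the graph of unit segments with rational angle every edge, read as a
    complex number, is a root of unity.  By Mann's theorem two sums of k roots
    of unity with the same value and without vanishing subsums have terms that
    agree up to P-th roots of unity, where P is the product of the primes up to
    2k; as P <= 4^(2k), at most (k 16^k)^k such sums have a given value.  In a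
    subgraph of minimum degree d > 2^k, extending walks greedily while avoiding
    vanishing subsums yields at least (d - 2^k)^k walks of length k from any
    vertex, hence (d - 2^k)^k <= n (k 16^k)^k.  With k about sqrt(log n) this
    forces d <= exp(6 sqrt(log n)); removing vertices of low degree one by one
    then bounds the number of edges.  For log n <= 36 the bound exceeds n^2. *)

(** * Primorials and the bound 4^n *)

Definition primorial (n : nat) : nat := (\prod_(0 <= p < n.+1 | prime p) p)%N.

Lemma prime_dvd_primorial (n p : nat) :
  prime p -> (p <= n)%N -> (p %| primorial n)%N.
Proof.
move=> pp lepn; rewrite /primorial big_mkcond.
by rewrite (bigD1_seq p) ?iota_uniq ?mem_index_iota //= pp dvdn_mulr.
Qed.

Lemma prime_dvd_fact (p n : nat) : prime p -> (p %| n`!)%N = (p <= n)%N.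
Proof.
move=> pp; apply/idP/idP => [|le_pn]; last first.
  by apply: dvdn_fact; rewrite prime_gt0.
elim: n => [|n IHn]; first by rewrite fact0 dvdn1 => /eqP p1; rewrite p1 in pp.
rewrite factS Euclid_dvdM // => /orP[/dvdn_leq -> //|/IHn/leq_trans]; exact.
Qed.

(** Distinct primes are coprime, so each new prime is coprime to the product of the rest and Gauss's
    lemma applies. *)
Lemma prod_primes_dvd (s : seq nat) (N : nat) :
  uniq s -> (forall p, p \in s -> prime p /\ (p %| N)%N) ->
  (\prod_(p <- s) p %| N)%N.
Proof.
elim: s => [|q s IHs] /=; first by rewrite big_nil dvd1n.
case/andP=> qs us sP; rewrite big_cons.
have [qp qN] := sP q (mem_head _ _).
rewrite Gauss_dvd ?qN ?IHs //.
  by move=> p ps; apply: sP; rewrite inE ps orbT.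
elim: {us IHs} s qs sP => [|r s IHs] qs sP; first by rewrite big_nil coprimen1.
move: qs; rewrite inE negb_or big_cons coprimeMr => /andP[qr qs].
apply/andP; split; last first.
  by apply: IHs => // p; rewrite inE => /orP[/eqP->|ps]; apply: sP;
    rewrite !inE ?eqxx ?ps ?orbT.
have [rp _] : prime r /\ (r %| N)%N by apply: sP; rewrite !inE eqxx orbT.
by rewrite prime_coprime // dvdn_prime2.
Qed.

(** The two middle coefficients of the expansion of (1 + 1)^(2m+1) are equal, so each is at most
    half of 2 * 4^m. *)
Lemma bin_odd_le (m : nat) : ('C(m.*2.+1, m) <= 4 ^ m)%N.
Proof.
have /eqP e2 : (2 ^ m.*2.+1 == \sum_(i < m.*2.+2) 'C(m.*2.+1, i))%N.
  by rewrite -[2%N]/(1 + 1)%N expnDn; apply/eqP/eq_bigr=> i _; rewrite !exp1n !muln1.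
have lt1 : (m < m.*2.+2)%N by lia.
have lt2 : (m.+1 < m.*2.+2)%N by lia.
have := leqnn (2 ^ m.*2.+1)%N; rewrite {1}e2.
rewrite (bigD1 (Ordinal lt1)) //= (bigD1 (Ordinal lt2)) /=; last first.
  by rewrite -val_eqE /= gtn_eqF.
have -> : 'C(m.*2.+1, m.+1) = 'C(m.*2.+1, m).
  by rewrite -[in RHS]bin_sub; [congr binomial; lia | lia].
have -> : (2 ^ m.*2.+1 = 2 * 4 ^ m)%N by rewrite expnS -mul2n expnM.
lia.
Qed.

(** Erdős's induction: an even n > 2 adds no prime, and for odd n the primes in the upper half all
    divide a middle binomial coefficient. *)
Lemma primorial_le (n : nat) : (primorial n <= 4 ^ n)%N.
Proof.
elim/ltn_ind: n => n IHn.
have [n2|n2] := leqP n 2.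
  case: n n2 {IHn} => [|[|[|]]] // _; by rewrite /primorial unlock.
have [on|en] := boolP (odd n); last first.
  have -> : primorial n = primorial n.-1.
    rewrite /primorial prednK; last by lia.
    rewrite big_mkcond big_nat_recr //= ifF ?muln1 -?big_mkcond //.
    apply/negP => /even_prime[|]; [lia | exact/negP].
  by apply: leq_trans (IHn _ _) _; [lia | rewrite leq_exp2l //; lia].
have [m nE] : exists m, n = m.*2.+1.
  by exists n./2; rewrite -[LHS]odd_double_half on.
rewrite {on n2}nE in IHn *.
case: m => [|m] in IHn *; first by rewrite /primorial unlock.
(* Here n = 2m+3. The first factor bounds the primes up to m+2 by induction; the second bounds
   'C(2m+3, m+1), which the primes from m+3 to n divide. *)
have -> : (4 ^ m.+1.*2.+1 = 4 ^ m.+2 * 4 ^ m.+1)%N.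
  rewrite -expnD; congr expn; lia.
rewrite /primorial (big_cat_nat (n := m.+3)) //=; last by lia.
apply: leq_mul; first by apply: IHn; lia.
apply: leq_trans (bin_odd_le _); apply: dvdn_leq; first by rewrite bin_gt0; lia.
rewrite -big_filter; apply: prod_primes_dvd; first by rewrite filter_uniq ?iota_uniq.
move=> p; rewrite mem_filter mem_index_iota => /andP[pp /andP[lp pl]]; split=> //.
have le : (m.+1 <= m.+1.*2.+1)%N by lia.
have : (p %| m.+1.*2.+1`!)%N by rewrite prime_dvd_fact //; lia.
rewrite -(bin_fact le) Euclid_dvdM // => /orP[//|].
rewrite Euclid_dvdM // !prime_dvd_fact //; move: lp; clear; lia.
Qed.

(** * Galois conjugation of roots of unity *)

(** Some factor [Cyclotomic d] of X^n - 1 with d dividing n vanishes at z; then z^d = 1, and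
    primitivity forces d = n. *)
Lemma root_Cyclotomic_map (K : numFieldType) (n : nat) (z : K) :
  n.-primitive_root z -> root (map_poly intr (Cyclotomic n)) z.
Proof.
move=> zP; have n0 := prim_order_gt0 zP.
have := congr1 (fun f => (map_poly (intr : int -> K) f).[z]) (prod_Cyclotomic n0).
rewrite rmorphB rmorph1 /= map_polyXn !hornerE (prim_expr_order zP) subrr.
rewrite rmorph_prod horner_prod /= => /eqP; rewrite prodf_seq_eq0 => /hasP[d].
rewrite -dvdn_divisors //= => dn /eqP zd.
have d0 : (0 < d)%N by apply: dvdn_gt0 dn.
have /eqP : z ^+ d = 1.
  apply/eqP; rewrite -subr_eq0; apply/eqP.
  have := congr1 (fun f => (map_poly (intr : int -> K) f).[z]) (prod_Cyclotomic d0).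
  rewrite rmorphB rmorph1 /= map_polyXn !hornerE => <-.
  by rewrite (big_rem d) -?dvdn_divisors //= rmorphM hornerM zd mul0r.
rewrite -(prim_order_dvd zP) => nd.
by rewrite rootE -(_ : d = n) ?zd //; apply/eqP; rewrite eqn_dvd dn.
Qed.

(** The cyclotomic polynomial is irreducible over the rationals, hence divides f, and z^t is another
    of its roots. Irreducibility is read off from minimal polynomials in [algC] and carried to K
    through rational polynomials. *)
Lemma root_prim_conj (K : numFieldType) (n t : nat) (z : K) (f : {poly int}) :
  n.-primitive_root z -> coprime t n ->
  root (map_poly intr f) z -> root (map_poly intr f) (z ^+ t).
Proof.
move=> zP tn fz; have n0 := prim_order_gt0 zP.
pose toQ : {poly int} -> {poly rat} := map_poly intr.
have toQK (L : numFieldType) h : map_poly (ratr : rat -> L) (toQ h) = map_poly intr h.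
  by rewrite -map_poly_comp; apply: eq_map_poly => b; rewrite /= rmorph_int.
have [w wP] := C_prim_root_exists n0.
have [p [pE _] pP] := minCpolyP w.
have pPhi : p = toQ (Cyclotomic n).
  apply: (map_inj_poly (fmorph_inj (ratr : {rmorphism rat -> algC}))).
    exact: rmorph0.
  rewrite -[LHS]pE (minCpoly_cyclotomic wP) -(Cintr_Cyclotomic wP).
  by symmetry; apply: toQK.
have pw : root (map_poly ratr p) w by rewrite pP.
have fw : p %| toQ f.
  rewrite -pP; apply: contraT => nfw.
  have p0 : p != 0.
    have := monic_neq0 (cyclotomic_monic w n).
    rewrite -(minCpoly_cyclotomic wP) pE.
    by apply: contraNneq => ->; rewrite rmorph0.
  (* In p = h * g the root w belongs to h or to g. The latter would make p divide f; the former
     makes p divide h, so g is constant. *)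
  have : coprimep p (toQ f).
    set g := gcdp p (toQ f).
    have /dvdpP[h pgh] : g %| p by apply: dvdp_gcdl.
    have : root (map_poly ratr p) w by [].
    rewrite {1}pgh rmorphM rootM /= => /orP[|gw]; last first.
      by case/negP: nfw; move: gw; rewrite !pP => gw; apply: dvdp_trans gw (dvdp_gcdr _ _).
    rewrite pP => ph; have h0 : h != 0 by apply: contraNneq p0 => h0; rewrite pgh h0 mul0r.
    have g0 : g != 0 by apply: contraNneq p0 => g0; rewrite pgh g0 mulr0.
    rewrite /coprimep -/g eqn_leq lt0n size_poly_eq0 g0 andbT.
    have := dvdp_leq h0 ph; rewrite {1}pgh size_mul //.
    have : (0 < size h)%N by rewrite lt0n size_poly_eq0.
    by case: (size g) => [|[|k]] //; lia.
  rewrite -(coprimep_map (ratr : {rmorphism rat -> K})) => /(@coprimep_root _ _ _ z).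
  by rewrite pPhi !toQK => /(_ (root_Cyclotomic_map zP)); rewrite -rootE fz.
have /dvdpP[h] := fw.
move/(congr1 (map_poly (ratr : rat -> K))); rewrite pPhi rmorphM /= !toQK => ->.
by rewrite rootM [X in _ || X]root_Cyclotomic_map ?orbT // prim_root_exp_coprime.
Qed.

(** * Vanishing sums of roots of unity and Mann's theorem *)

Lemma prim_root_sum_exp (K : fieldType) (p k : nat) (z : K) :
  p.-primitive_root z ->
  \sum_(u < p) z ^+ (u * k) = if (p %| k)%N then p%:R else 0.
Proof.
move=> zP; rewrite (eq_bigr (fun u : 'I_p => (z ^+ k) ^+ u)); last first.
  by move=> u _; rewrite mulnC exprM.
have [pk|npk] := ifPn.
  have -> : z ^+ k = 1 by apply/eqP; rewrite -(prim_order_dvd zP).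
  by rewrite (eq_bigr (fun=> 1)) => [|u _]; rewrite ?expr1n ?sumr_const ?card_ord.
have zk1 : z ^+ k - 1 != 0 by rewrite subr_eq0 -(prim_order_dvd zP).
apply: (mulfI zk1); rewrite mulr0 -subrX1 -exprM mulnC exprM.
by rewrite (prim_expr_order zP) expr1n subrr.
Qed.

Lemma missing_residue (I : finType) (A : {set I}) (e : I -> nat) (p : nat) :
  (#|A| < p)%N -> exists2 r, (r < p)%N & forall i, i \in A -> (e i %% p)%N != r.
Proof.
case: p => // p Ap.
pose B := [set (inord (e i %% p.+1) : 'I_p.+1) | i in A].
have : ~: B != finset.set0.
  rewrite -card_gt0 -(ltn_add2l #|B|) addn0 cardsC card_ord.
  exact: leq_ltn_trans (leq_imset_card _ _) Ap.
case/set0Pn=> r; rewrite inE => rB; exists r => // i iA.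
apply: contraNneq rB => er; apply/imsetP; exists i => //.
by apply: val_inj; rewrite /= inordK ?ltn_pmod.
Qed.

(* Conjugating by z |-> z^(1 + N u) multiplies each term by a power of the
   p-th root of unity z^N, so the discrete Fourier transform of the vector of
   class sums vanishes everywhere, except possibly at one frequency when p does
   not divide N; an empty class then forces the last coefficient to vanish. *)
Lemma vanishing_sum_mod_prime (K : numFieldType) (I : finType) (A : {set I})
    (c : I -> int) (e : I -> nat) (z : K) (p N : nat) :
  prime p -> (p * N).-primitive_root z ->
  \sum_(i in A) (c i)%:~R * z ^+ e i = 0 ->
  (p %| N)%N \/ (#|A| < p)%N ->
  \sum_(i in A | (p %| e i)%N) (c i)%:~R * z ^+ e i = 0.
Proof.
move=> pp zP sum0 pN.
have p0 := prime_gt0 pp.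
have N0 : (0 < N)%N by have := prim_order_gt0 zP; rewrite muln_gt0 => /andP[].
have zetaP : p.-primitive_root (z ^+ N).
  by have := dvdn_prim_root zP (dvdn_mulr N (dvdnn p)); rewrite mulKn.
set zeta := z ^+ N in zetaP.
pose F u : K := \sum_(i in A) (c i)%:~R * z ^+ e i * zeta ^+ (u * e i).
have conjF u : coprime (1 + N * u) p -> F u = 0.
  move=> cop; pose f := \sum_(i in A) (c i)%:P * 'X^(e i) : {poly int}.
  have fE x : (map_poly intr f).[x] = \sum_(i in A) (c i)%:~R * x ^+ e i :> K.
    rewrite rmorph_sum horner_sum; apply: eq_bigr => i _.
    by rewrite rmorphM /= map_polyC map_polyXn !hornerE.
  have cop2 : coprime (1 + N * u) (p * N).
    by rewrite coprimeMr cop /= /coprime gcdnC addnC mulnC gcdnMDl gcdn1.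
  have := root_prim_conj (f := f) zP cop2.
  rewrite !rootE !fE sum0 eqxx => /(_ isT)/eqP <-.
  apply: eq_bigr => i _; rewrite -mulrA; congr (_ * _).
  by rewrite -!exprM -exprD; congr (_ ^+ _); lia.
(* Fourier inversion: the weights zeta^(u s) single out the terms with exponent congruent to -s mod
   p. *)
have sumF s : \sum_(u < p) zeta ^+ (u * s) * F u =
    p%:R * \sum_(i in A | (p %| e i + s)%N) (c i)%:~R * z ^+ e i.
  under eq_bigr do rewrite mulr_sumr.
  rewrite exchange_big /= big_mkcondr /= mulr_sumr; apply: eq_bigr => i _.
  have := prim_root_sum_exp (e i + s) zetaP => E.
  transitivity ((c i)%:~R * z ^+ e i * \sum_(u < p) zeta ^+ (u * (e i + s))).
    rewrite mulr_sumr; apply: eq_bigr => u _.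
    by rewrite mulnDr exprD; ring.
  by rewrite E; case: ifP => _; rewrite ?mulr0 // mulrC.
have F0 (u : 'I_p) : F u = 0.
  have [/conjF//|ncop] := boolP (coprime (1 + N * u) p).
  rewrite coprime_sym prime_coprime // negbK in ncop.
  case: pN => [/dvdnP[q NE]|/(missing_residue e)[r rp rA]].
    move: ncop; rewrite NE mulnAC dvdn_addl ?dvdn_mull // dvdn1 => /eqP p1.
    by rewrite p1 in pp.
  (* When p does not divide 1 + N u for two different u below p: at most one frequency u makes 1 + N
     u divisible by p, so all others are killed by conjugation. *)
  have inj a b : (a <= b < p)%N -> (p %| 1 + N * a)%N -> (p %| 1 + N * b)%N -> a = b.
    move=> /andP[ab bp] pa pb; have := dvdn_sub pb pa.
    rewrite subnDl -mulnBr Euclid_dvdM // => /orP[pN|].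
      by move: pa; rewrite dvdn_addl ?dvdn_mulr // dvdn1 => /eqP p1; rewrite p1 in pp.
    by have [ba _|ba0 /dvdn_leq-/(_ ba0)] := posnP (b - a)%N; lia.
  (* The shift p - r selects the empty class r, leaving a nonzero multiple of the exceptional F u
     equal to 0. *)
  have := sumF (p - r)%N; rewrite [in RHS]big1 ?mulr0; last first.
    move=> i /andP[iA] /eqP pd; case/eqP: (rA i iA).
    rewrite -(modnDr (e i) p) -{1}(subnK (ltnW rp)) addnA -modnDml pd.
    by rewrite add0n modn_small.
  rewrite (bigD1 u) //= [X in _ + X]big1 ?addr0; last first.
    move=> v vu; rewrite conjF ?mulr0 // coprime_sym prime_coprime //.
    apply: contra vu => pv; apply/eqP/val_inj.
    by have [uv|/ltnW vu] := leqP u v; [symmetry|]; apply: inj => //; rewrite ?uv ?vu /=.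
  move/eqP; rewrite mulf_eq0 => /orP[|/eqP//].
  by rewrite expf_eq0 (prim_root_eq0 zetaP) gtn_eqF // andbF.
have := sumF 0%N; rewrite big1 => [|u _]; last by rewrite F0 mulr0.
move/esym/eqP; rewrite mulf_eq0 pnatr_eq0 -leqn0 leqNgt p0 /= => /eqP.
by under eq_bigl do rewrite addn0.
Qed.

Lemma prim_root_exists (K : numClosedFieldType) (n : nat) :
  (0 < n)%N -> exists z : K, n.-primitive_root z.
Proof.
move=> n0; have [r] := closed_field_poly_normal ('X^n - 1 : {poly K}).
rewrite (monicP _) ?monicXnsubC // scale1r => Dr.
have sr : (n < (size r).+1)%N by rewrite -(size_prod_XsubC r id) -Dr size_XnsubC.
have rn1 : all n.-unity_root r by apply/allP=> z; rewrite -root_prod_XsubC -Dr.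
have [|z] := hasP (has_prim_root n0 rn1 _ sr); last by exists z.
by rewrite -separable_prod_XsubC -Dr separable_Xn_sub_1 // pnatr_eq0 -lt0n.
Qed.

(* Mann's theorem, in the form: a vanishing sum of at most m roots of unity
   splits into vanishing sums over the cosets of the P-th roots of unity. *)
Lemma vanishing_sum_class (K : numClosedFieldType) (I : finType) (w : I -> K)
    (c : I -> int) (P m : nat) :
  (0 < P)%N -> (forall p, prime p -> (p <= m)%N -> (p %| P)%N) ->
  forall (N : nat) (A : {set I}) (j : I), (0 < N)%N -> (#|A| <= m)%N -> w j != 0 ->
  (forall i, i \in A -> w i ^+ N = w j ^+ N) ->
  \sum_(i in A) (c i)%:~R * w i = 0 ->
  \sum_(i in A | w i ^+ P == w j ^+ P) (c i)%:~R * w i = 0.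
Proof.
move=> P0 primeP; elim/ltn_ind => N IHN A j N0 Am wj0 wN sum0.
have [NP|nNP] := boolP (N %| P)%N.
  rewrite -[RHS]sum0; apply: eq_bigl => i; have [iA|//] /= := boolP (i \in A).
  by have /dvdnP[q ->] := NP; rewrite mulnC !exprM wN // eqxx.
(* Descent on N: a prime occurring to a higher power in N than in P is divided out of N, giving N' =
   N / p. *)
have [p pp ltp] : exists2 p, prime p & (logn p P < logn p N)%N.
  have [/existsP[p /andP[pp ?]]|] :=
    boolP [exists p : 'I_N.+1, prime p && (logn p P < logn p N)%N]; first by exists p.
  rewrite negb_exists => /forallP all_le; case/negP: nNP.
  apply/dvdn_partP => // p; rewrite mem_primes => /and3P[pp _ pN].
  rewrite p_part pfactor_dvdn // leqNgt.
  have pN1 : (p < N.+1)%N by rewrite ltnS dvdn_leq.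
  by have := all_le (Ordinal pN1); rewrite negb_and pp.
have pN : (p %| N)%N by rewrite -[p]expn1 pfactor_dvdn // (leq_trans _ ltp).
have [N' NE] := dvdnP pN; have p0 := prime_gt0 pp.
rewrite mulnC in NE; have N'0 : (0 < N')%N by move: N0; rewrite NE muln_gt0 => /andP[].
(* The order d of w i / w j divides both N and P. As p occurs less often in P than in N, it divides
   N / d, so d divides N'. *)
have wPN' i : i \in A -> w i ^+ P = w j ^+ P -> w i ^+ N' = w j ^+ N'.
  move=> iA wP; pose x := w i / w j.
  have x1 k : w i ^+ k = w j ^+ k <-> x ^+ k = 1.
    rewrite exprMn exprVn; split=> [->|]; first by rewrite mulfV ?expf_neq0.
    by move/(canRL (mulfVK (expf_neq0 _ wj0))); rewrite mul1r.
  have /(prim_order_exists N0)[d dx dN] : x ^+ N = 1 by apply/x1/wN.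
  have dP : (d %| P)%N by rewrite (prim_order_dvd dx); apply/eqP/x1.
  apply/x1/eqP; rewrite -(prim_order_dvd dx).
  have [h NdE] := dvdnP dN.
  have h0 : (0 < h)%N by move: N0; rewrite NdE muln_gt0 => /andP[].
  have d0 := prim_order_gt0 dx.
  have : (0 < logn p h)%N.
    have := dvdn_leq_log p P0 dP; move: ltp; rewrite NdE lognM //; lia.
  rewrite logn_gt0 mem_primes => /and3P[_ _ /dvdnP[q hE]].
  apply/dvdnP; exists q; apply/eqP; rewrite -(eqn_pmul2l p0) -NE NdE hE.
  by rewrite -mulnA mulnCA.
pose B := [set i in A | w i ^+ N' == w j ^+ N'].
have := IHN N' _ B j N'0 _ wj0.
have -> : \sum_(i in B | w i ^+ P == w j ^+ P) (c i)%:~R * w i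
        = \sum_(i in A | w i ^+ P == w j ^+ P) (c i)%:~R * w i.
  apply: eq_bigl => i; rewrite inE -andbA; apply: andb_id2l => iA.
  by apply: andb_idl => /eqP/wPN'->.
apply.
- by rewrite NE -[X in (X < _)%N]mul1n ltn_pmul2r // prime_gt1.
- by apply: leq_trans Am; apply/subset_leq_card/fintype.subsetP => i; rewrite inE => /andP[].
- by move=> i; rewrite inE => /andP[_ /eqP].
(* Division by [w j] turns the terms into powers of a primitive N-th root z; p divides the exponent
   exactly for the terms in [B]. *)
have [z zP] := prim_root_exists K N0.
have [e eP] : exists e : I -> nat, forall i, i \in A -> w i / w j = z ^+ e i.
  apply: (@fin_all_exists _ _ (fun i k => i \in A -> w i / w j = z ^+ k)) => i.
  have [iA|] := boolP (i \in A); last by exists 0%N.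
  have [|k ->] := prim_rootP zP (_ : (w i / w j) ^+ N = 1); last by exists k.
  by rewrite exprMn exprVn wN // mulfV ?expf_neq0.
rewrite NE in zP.
have wE i : i \in A -> w i = z ^+ e i * w j by move=> /eP <-; rewrite mulfVK.
have := vanishing_sum_mod_prime (c := c) (e := e) (A := A) pp zP.
move=> step; rewrite -[RHS](mul0r (w j)) -[X in _ = X * _]step ?mulr_suml.
- apply: eq_big => [i|i]; last by rewrite inE => /andP[iA _]; rewrite (wE i iA) mulrA.
  rewrite inE; apply: andb_id2l => iA.
  rewrite (wE i iA) exprMn -subr_eq0 -[X in _ - X]mul1r -mulrBl mulf_eq0.
  rewrite [X in _ || X](negbTE (expf_neq0 _ wj0)) orbF subr_eq0 -exprM.
  by rewrite -(prim_order_dvd zP) dvdn_pmul2r.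
- apply: (mulIf wj0); rewrite mul0r -[RHS]sum0 mulr_suml; apply: eq_bigr => i iA.
  by rewrite [in RHS](wE i iA) mulrA.
(* If p <= m then p divides P, so p^2 divides N and p still divides N'; otherwise there are fewer
   than p terms. *)
- have [pm|mp] := leqP p m; last by right; apply: leq_ltn_trans mp.
  left; have := primeP p pp pm; rewrite -[p in (p %| P)%N]expn1 pfactor_dvdn //.
  move=> lP; have := leq_ltn_trans lP ltp; rewrite NE lognM // logn_prime // eqxx.
  by rewrite ltnS logn_gt0 mem_primes => /and3P[].
Qed.

(** * Sums without vanishing subsums *)

(** Repeated values are kept and the empty sum 0 is included, so the length is exactly a power of
    2. *)
Definition subsums (V : zmodType) (s : seq V) : seq V :=
  foldr (fun x t => t ++ map (+%R x) t) [:: 0] s.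

(** No nonempty subsum vanishes: one that first uses x is zero exactly when - x is a subsum of the
    tail. *)
Fixpoint irredundant (V : zmodType) (s : seq V) : bool :=
  if s is x :: s' then (- x \notin subsums s') && irredundant s' else true.

Definition root_of_unity (K : fieldType) (x : K) : Prop :=
  exists2 n, (0 < n)%N & x ^+ n = 1.

Lemma size_subsums (V : zmodType) (s : seq V) : size (subsums s) = (2 ^ size s)%N.
Proof.
by elim: s => //= x s IHs; rewrite size_cat size_map -/(subsums s) IHs expnS mul2n addnn.
Qed.

Lemma mem_subsums (V : zmodType) (s : seq V) (Q : pred V) :
  \sum_(x <- s | Q x) x \in subsums s.
Proof.
elim: s => [|x s IHs] /=; first by rewrite big_nil mem_head.
rewrite big_cons mem_cat -/(subsums s); case: (Q x); last by rewrite IHs.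
by rewrite map_f ?orbT.
Qed.

Lemma irredundant_sum_neq0 (V : zmodType) (s : seq V) (Q : pred V) :
  irredundant s -> has Q s -> \sum_(x <- s | Q x) x != 0.
Proof.
elim: s => //= x s IHs /andP[xs irr_s]; rewrite big_cons.
case: (Q x) => [_|]; last exact: IHs.
by apply: contraNneq xs => /eqP; rewrite addr_eq0 -eqr_oppLR => /eqP->; rewrite mem_subsums.
Qed.

Lemma root_of_unity_neq0 (K : fieldType) (x : K) : root_of_unity x -> x != 0.
Proof.
case=> n n0; apply: contra_eqN => /eqP->.
by rewrite expr0n gtn_eqF // eq_sym oner_eq0.
Qed.

Lemma common_unity_exponent (K : fieldType) (s : seq K) :
  (forall x, x \in s -> root_of_unity x) ->
  exists2 n, (0 < n)%N & forall x, x \in s -> x ^+ n = 1.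
Proof.
elim: s => [|x s IHs] sP; first by exists 1%N.
have [|n n0 nP] := IHs; first by move=> y ys; apply: sP; rewrite inE ys orbT.
have [m m0 xm] := sP x (mem_head _ _).
exists (m * n)%N; first by rewrite muln_gt0 m0.
move=> y; rewrite inE => /predU1P[->|/nP yn]; first by rewrite exprM xm expr1n.
by rewrite mulnC exprM yn expr1n.
Qed.

(** Mann's theorem is applied to the 2k terms of s and -t, whence the integer coefficients 1 and -1.
    If the class of y missed t, its class sum would be a nonempty vanishing subsum of s. *)
Lemma irredundant_same_class (K : numClosedFieldType) (s t : seq K) (k P : nat) (y : K) :
  (0 < P)%N -> (forall p, prime p -> (p <= k + k)%N -> (p %| P)%N) ->
  size s = k -> size t = k -> irredundant s ->
  (forall x, x \in s ++ t -> root_of_unity x) ->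
  \sum_(x <- s) x = \sum_(x <- t) x -> y \in s ->
  exists2 x, x \in t & y ^+ P = x ^+ P.
Proof.
move=> P0 primeP sk tk irr_s unity sum_st ys.
have [/hasP[x xt /eqP]|hasNt] := boolP (has (fun x => y ^+ P == x ^+ P) t); first by exists x.
have [N N0 NP] := common_unity_exponent unity.
pose w (i : 'I_k + 'I_k) : K := match i with inl a => s`_a | inr a => t`_a end.
pose c (i : 'I_k + 'I_k) : int := if i is inl _ then 1 else -1.
have wP i : w i \in s ++ t.
  by rewrite mem_cat; case: i => a /=; rewrite mem_nth ?orbT // ?sk ?tk.
have yk : (index y s < k)%N by rewrite -sk index_mem.
pose j : 'I_k + 'I_k := inl (Ordinal yk).
have wj : w j = y by rewrite /= nth_index.
have sumE (r : seq K) (Q : pred K) : size r = k ->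
    \sum_(a < k | Q r`_a) r`_a = \sum_(x <- r | Q x) x.
  by move=> rk; rewrite [RHS](big_nth 0) big_mkord rk.
have := @vanishing_sum_class K _ w c P (k + k) P0 primeP N [set: _] j N0.
rewrite cardsT card_sum !card_ord leqnn wj => /(_ isT)-step.
have : \sum_(i in [set: 'I_k + 'I_k] | w i ^+ P == y ^+ P) (c i)%:~R * w i = 0.
  apply: step; first by apply/root_of_unity_neq0/unity; rewrite mem_cat ys.
    by move=> i _; rewrite !NP // mem_cat ys.
  rewrite big_sumType /= (eq_bigl predT) => [|a]; last by rewrite inE.
  rewrite [X in _ + X](eq_bigl predT) => [|a]; last by rewrite inE.
  under eq_bigr do rewrite mul1r.
  under [X in _ + X]eq_bigr do rewrite mulN1r.
  by rewrite sumrN !(sumE _ predT) // sum_st subrr.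
rewrite big_sumType /=.
under eq_bigl do rewrite inE /=.
under eq_bigr do rewrite mul1r.
under [X in _ + X]eq_bigl do rewrite inE /=.
rewrite (sumE s (fun x => x ^+ P == y ^+ P)) // [X in _ + X]big1 => [|a /eqP ta].
  rewrite addr0 => /eqP sum0; have := irredundant_sum_neq0 irr_s _.
  move/(_ (fun x => x ^+ P == y ^+ P)); rewrite sum0 => /(_ _)/negP[] //.
  by apply/hasP; exists y.
by case/negP: hasNt; apply/hasP; exists t`_a; rewrite ?mem_nth ?tk //= ta.
Qed.

(** [C] collects, for each entry b of t, the P roots of X^P - b^P. *)
Lemma roots_of_power (K : closedFieldType) (P : nat) (t : seq K) :
  (0 < P)%N ->
  exists2 C : seq K, size C = (size t * P)%N &
    forall x y, x \in t -> y ^+ P = x ^+ P -> y \in C.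
Proof.
move=> P0; elim: t => [|b t [C sC CP]]; first by exists [::].
have [r] := closed_field_poly_normal ('X^P - (b ^+ P)%:P : {poly K}).
rewrite (monicP _) ?monicXnsubC // scale1r => Dr.
exists (r ++ C).
  rewrite size_cat sC mulSn; congr addn; apply: succn_inj.
  by rewrite -(size_prod_XsubC r id) -Dr size_XnsubC.
move=> x y; rewrite inE mem_cat => /predU1P[->|xt] yx; last by rewrite (CP x) ?orbT.
by rewrite -[y \in r]root_prod_XsubC -Dr rootE !hornerE yx subrr eqxx.
Qed.

Lemma size_words (T : eqType) (C : seq T) (k : nat) (U : seq (seq T)) :
  uniq U -> (forall s, s \in U -> size s = k /\ {subset s <= C}) ->
  (size U <= size C ^ k)%N.
Proof.
move=> uU UP; pose words := iter k (fun W => [seq x :: s | x <- C, s <- W]) [:: [::]].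
have -> : (size C ^ k = size words)%N.
  by rewrite /words; elim: k {UP words} => //= k IHk; rewrite size_allpairs -IHk expnS.
apply: uniq_leq_size => // s /UP[]; rewrite /words.
elim: k s {UP words} => [|k IHk] [|x s] //= [sk] sC.
by apply/allpairsP; exists (x, s); split; rewrite //= ?sC ?mem_head //;
  apply: IHk => // y ys; apply: sC; rewrite inE ys orbT.
Qed.

(** With one such sum t fixed, every other one is a word of length k over the k P candidates that t
    determines. *)
Lemma irredundant_sums_count (K : numClosedFieldType) (k : nat) (a : K) (U : seq (seq K)) :
  uniq U ->
  (forall s, s \in U -> [/\ size s = k, irredundant s,
     (forall x, x \in s -> root_of_unity x) & \sum_(x <- s) x = a]) ->
  (size U <= (k * primorial (k + k)) ^ k)%N.
Proof.
case: U => // t U uU UP; set P := primorial _.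
have P0 : (0 < P)%N.
  rewrite /P /primorial big_mkcond prodn_gt0 // => i.
  by case: ifP => // /prime_gt0.
have [tk _ tu ta] := UP t (mem_head _ _).
have [C sC CP] := roots_of_power t P0.
rewrite -tk -sC tk; apply: size_words => // s sU.
have [sk irr_s su sa] := UP s sU; split=> // y ys.
have [|||x xt] := irredundant_same_class (t := t) P0 _ sk tk irr_s _ _ ys.
- exact: prime_dvd_primorial.
- by move=> x; rewrite mem_cat => /orP[/su|/tu].
- by rewrite sa.
exact: CP.
Qed.

(** * Counting walks *)

Lemma size_fibers_le (T T' : eqType) (f : T -> T') (W : seq T) (A : seq T') (B : nat) :
  (forall x, x \in W -> f x \in A) ->
  (forall a, a \in A -> (count (fun x => f x == a) W <= B)%N) ->
  (size W <= size A * B)%N.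
Proof.
elim: A W => [|a A IHA] W WA WB.
  by case: W WA {WB} => // x W /(_ x (mem_head _ _)).
rewrite -(count_predC (fun x => f x == a)) mulSn leq_add ?WB ?mem_head //.
rewrite -size_filter; apply: IHA => [x|b bA].
  by rewrite mem_filter => /andP[/= fxa /WA]; rewrite inE (negbTE fxa).
rewrite count_filter; apply: leq_trans (WB b _); last by rewrite inE bA orbT.
by apply: sub_count => x /andP[].
Qed.

(** [q] is the current endpoint of the walk; the filter is the condition that keeps x :: s
    irredundant. *)
Definition next_steps (K : fieldType) (adj : rel K) (A : seq K) (v : K) (s : seq K) : seq K :=
  let q := v + \sum_(x <- s) x in
  [seq x <- [seq p - q | p <- A & adj q p] | - x \notin subsums s].

(* Walks in A from v without vanishing subsums, recorded by their steps, the
   last step first. *)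
Fixpoint walks (K : fieldType) (adj : rel K) (A : seq K) (v : K) (k : nat) : seq (seq K) :=
  if k is k'.+1 then
    [seq x :: s | s <- walks adj A v k', x <- next_steps adj A v s]
  else [:: [::]].

Lemma walksP (K : fieldType) (adj : rel K) (A : seq K) (v : K) (k : nat) (s : seq K) :
  (forall p q, adj p q -> root_of_unity (q - p)) -> v \in A -> s \in walks adj A v k ->
  [/\ size s = k, irredundant s, (forall x, x \in s -> root_of_unity x)
    & v + \sum_(x <- s) x \in A].
Proof.
move=> adjP vA; elim: k s => [|k IHk] s /=.
  by rewrite inE => /eqP->; split=> //; rewrite big_nil addr0.
case/allpairsPdep=> t [x [/IHk[tk irr_t tu tA] + ->]].
rewrite mem_filter => /andP[xt /mapP[p]]; rewrite mem_filter => /andP[adjp pA] xE.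
split; rewrite /= ?tk ?xt //.
  by move=> y; rewrite inE => /predU1P[->|/tu//]; rewrite xE; apply: adjP.
by rewrite big_cons xE addrC -addrA [_ + v]addrC subrK.
Qed.

Lemma uniq_next_steps (K : fieldType) (adj : rel K) (A : seq K) (v : K) (s : seq K) :
  uniq A -> uniq (next_steps adj A v s).
Proof. by move=> uA; rewrite filter_uniq // map_inj_uniq ?filter_uniq //; apply: addIr. Qed.

Lemma uniq_walks (K : fieldType) (adj : rel K) (A : seq K) (v : K) (k : nat) :
  uniq A -> uniq (walks adj A v k).
Proof.
move=> uA; elim: k => //= k IHk; apply: allpairs_uniq_dep => //.
  by move=> s _; apply: uniq_next_steps.
by move=> [s x] [t y] _ _ /= [-> ->].
Qed.

(** After j < k steps at least d neighbours are available, and negation injects the rejected steps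
    into the 2^j subsums. The subtraction is truncated, so small d is harmless. *)
Lemma size_walks (K : fieldType) (adj : rel K) (A : seq K) (v : K) (k d : nat) :
  uniq A -> (forall p q, adj p q -> root_of_unity (q - p)) -> v \in A ->
  (forall p, p \in A -> d <= count (adj p) A)%N ->
  ((d - 2 ^ k) ^ k <= size (walks adj A v k))%N.
Proof.
move=> uA adjP vA degA.
suff sub j : (j <= k)%N -> ((d - 2 ^ k) ^ j <= size (walks adj A v j))%N by apply: sub.
elim: j => // j IHj jk; rewrite expnS mulnC /= size_allpairs_dep.
apply: leq_trans (_ : size (walks adj A v j) * (d - 2 ^ k) <= _)%N.
  by rewrite leq_mul2r IHj ?orbT // ltnW.
have: {in walks adj A v j, forall s, d - 2 ^ k <= size (next_steps adj A v s)}%N.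
  move=> s /walksP[]// sj _ _ sA; rewrite leq_subLR.
  apply: leq_trans (degA _ sA) _; rewrite -size_filter.
  rewrite -(size_map (fun p => p - (v + \sum_(x <- s) x))).
  set N := map _ _; rewrite -(count_predC (fun x => - x \in subsums s) N) leq_add //.
    apply: leq_trans (_ : 2 ^ j <= _)%N; last by rewrite leq_exp2l // ltnW.
    rewrite -sj -size_subsums -size_filter -(size_map -%R); apply: uniq_leq_size.
      rewrite map_inj_uniq; last exact: oppr_inj.
      by rewrite filter_uniq // map_inj_uniq ?filter_uniq //; apply: addIr.
    by move=> _ /mapP[x + ->]; rewrite mem_filter => /andP[].
  by rewrite /next_steps size_filter.
elim: (walks adj A v j) => //= s W IHW WP; rewrite mulSn leq_add ?WP ?mem_head // IHW //.
by move=> t tW; rewrite WP // inE tW orbT.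
Qed.

(** Walks from v are sorted by endpoint: there are at most [size A] endpoints a, and each receives
    only irredundant sums of value a - v. *)
Lemma min_degree_bound (K : numClosedFieldType) (adj : rel K) (A : seq K) (k d : nat) :
  (forall p q, adj p q -> root_of_unity (q - p)) -> uniq A -> A != [::] ->
  (forall p, p \in A -> d <= count (adj p) A)%N ->
  ((d - 2 ^ k) ^ k <= size A * (k * primorial (k + k)) ^ k)%N.
Proof.
move=> adjP uA; case: A uA => // v A' uA _; set A := v :: A' => degA.
have vA : v \in A by apply: mem_head.
apply: leq_trans (size_walks k uA adjP vA degA) _.
apply: (size_fibers_le (f := fun s => v + \sum_(x <- s) x)) => [s|a aA].
  by case/(walksP adjP vA).
rewrite -size_filter; apply: (irredundant_sums_count (a := a - v)).
  exact/filter_uniq/uniq_walks.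
move=> s; rewrite mem_filter => /andP[/eqP sa /(walksP adjP vA)[]] *; split=> //.
by rewrite -sa addrC addKr.
Qed.

(** * Edge counting by removing vertices of low degree *)

(** Removing a vertex of degree at most D lowers the degree sum by twice its degree, and the
    hypothesis passes to sublists. *)
Lemma degree_sum_bound (T : eqType) (adj : rel T) (D : nat) :
  symmetric adj -> irreflexive adj -> forall A : seq T, uniq A ->
  (forall B, uniq B -> {subset B <= A} -> B != [::] ->
     exists2 p, p \in B & (count (adj p) B <= D)%N) ->
  (\sum_(p <- A) count (adj p) A <= 2 * D * size A)%N.
Proof.
move=> sym irr A; move: {2}(size A) (erefl (size A)) => n.
elim: n A => [|n IHn] A sA uA AP; first by rewrite (size0nil sA) big_nil.
have [|v vA vD] := AP A uA (fun _ => id); first by rewrite -size_eq0 sA.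
have pA := perm_to_rem vA; set A' := rem v A in pA.
have sA' : size A' = n by rewrite /A' size_rem // sA.
have uA' : uniq A' by apply: rem_uniq.
have {}IHn : (\sum_(p <- A') count (adj p) A' <= 2 * D * size A')%N.
  apply: IHn => // B uB BA'; apply: AP => // p /BA'; exact: mem_rem.
have cA p : count (adj p) A = (adj p v + count (adj p) A')%N.
  by rewrite (permP pA).
rewrite (perm_big _ pA) big_cons cA irr /=.
under eq_bigr do rewrite cA.
rewrite big_split /=.
have -> : (\sum_(p <- A') adj p v = count (adj v) A')%N.
  by rewrite -sum1_count [RHS]big_mkcond; apply: eq_bigr => p _; rewrite sym; case: (adj v p).
move: vD IHn; rewrite cA irr sA' sA /=; lia.
Qed.

(** * From rational angles to roots of unity *)

Lemma root_of_unityN (K : fieldType) (x : K) : root_of_unity x -> root_of_unity (- x).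
Proof.
case=> n n0 xn; exists (n * 2)%N; first by rewrite muln_gt0 n0.
by rewrite mulnC exprM sqrrN -exprM mulnC exprM xn expr1n.
Qed.

Lemma complex_deMoivre (R : realType) (t : R) (n : nat) :
  (Complex (cos t) (sin t)) ^+ n = Complex (cos (t *+ n)) (sin (t *+ n)).
Proof.
elim: n => [|n IHn]; first by rewrite expr0 mulr0n cos0 sin0.
rewrite exprS IHn mulrS cosD sinD; apply/eqP; rewrite eq_complex /=.
by rewrite eqxx /= addrC eqxx.
Qed.

Lemma sin_pi_int (R : realType) (a : int) : sin (pi *~ a : R) = 0.
Proof.
have sin_nat n : sin (pi *+ n : R) = 0.
  elim: n => [|n IHn]; first by rewrite mulr0n sin0.
  by rewrite mulrSr sinDpi IHn oppr0.
case: a => n; first exact: sin_nat.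
by rewrite NegzE mulrNz sinN -pmulrn sin_nat oppr0.
Qed.

(** The power [|denq g|] brings the angle to an integer multiple of pi, giving 1 or -1; the extra
    factor 2 removes the sign. *)
Lemma root_of_unity_rat_angle (R : realType) (g : rat) :
  root_of_unity (Complex (cos (pi * ratr g : R)) (sin (pi * ratr g))).
Proof.
have dg : (0 < `|denq g|)%N by rewrite absz_gt0 denq_neq0.
exists (`|denq g| * 2)%N; first by rewrite muln_gt0 dg.
have angle : (pi * ratr g : R) *+ `|denq g| = pi *~ numq g.
  rewrite -mulr_natr -mulrA -mulrzr; congr (_ * _).
  rewrite pmulrn absz_denq /ratr -mulrA mulVf ?mulr1 //.
  by rewrite intr_eq0 denq_neq0.
rewrite exprM complex_deMoivre angle sin_pi_int.
apply/eqP; rewrite expr2 eq_complex /= !mulr0 !mul0r subr0 addr0 eqxx andbT.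
by rewrite -expr2 -(cos2Dsin2 (pi *~ numq g)) sin_pi_int expr0n addr0.
Qed.

Lemma good_pair_root_of_unity (R : realType) (p q : R * R) :
  good_pair p q -> root_of_unity (Complex q.1 q.2 - Complex p.1 p.2).
Proof.
case/asboolP=> upq [r [g [r0 [xE yE]]]].
suff r1 : r = 1.
  have -> : Complex q.1 q.2 - Complex p.1 p.2 =
      Complex (cos (pi * ratr g)) (sin (pi * ratr g)).
    by apply/eqP; rewrite eq_complex /= xE yE r1 !mul1r !eqxx.
  exact: root_of_unity_rat_angle.
move: upq; rewrite /unit_dist xE yE !exprMn -mulrDr cos2Dsin2 mulr1 sqrtr_sqr.
by rewrite gtr0_norm.
Qed.

Lemma sum_lt_sym (n : nat) (a : 'I_n -> 'I_n -> nat) :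
  (forall i j, a i j = a j i) ->
  (2 * (\sum_(i < n) \sum_(j < n | (i < j)%N) a i j) <= \sum_(i < n) \sum_(j < n) a i j)%N.
Proof.
move=> sym; rewrite mul2n -addnn.
have {2}-> : (\sum_(i < n) \sum_(j < n | (i < j)%N) a i j =
    \sum_(i < n) \sum_(j < n | (j < i)%N) a i j)%N.
  rewrite (exchange_big_dep predT) //=; apply: eq_bigr => j _.
  by apply: eq_bigr => i _; apply: sym.
rewrite -big_split /=; apply: leq_sum => i _.
rewrite big_mkcond [X in (_ + X)%N]big_mkcond -big_split /=.
by apply: leq_sum => j _; case: ltngtP; rewrite ?addn0.
Qed.

(** It suffices that [adj] contain the good pairs, so a larger symmetric relation may replace
    them. *)
Lemma count_good_pairs_le (R : realType) (S : seq (R * R)) (adj : rel R[i]) :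
  symmetric adj ->
  (forall p q, good_pair p q -> adj (Complex p.1 p.2) (Complex q.1 q.2)) ->
  (2 * count_good_pairs S <=
    \sum_(x <- [seq Complex p.1 p.2 | p <- S])
       count (adj x) [seq Complex p.1 p.2 | p <- S])%N.
Proof.
move=> sym adjP; set A := map _ _; pose toC (p : R * R) := Complex p.1 p.2.
pose s i := nth (0%R : R, 0%R : R) S i.
have -> : (\sum_(x <- A) count (adj x) A =
    \sum_(i < size S) \sum_(j < size S) adj (toC (s i)) (toC (s j)))%N.
  rewrite big_map (big_nth (0, 0)) big_mkord; apply: eq_bigr => i _.
  by rewrite -sum1_count big_mkcond big_map (big_nth (0, 0)) big_mkord.
apply: leq_trans (sum_lt_sym _); last by move=> i j; rewrite sym.
rewrite leq_mul2l /=; apply: leq_sum => i _; apply: leq_sum => j _.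
by rewrite -/(s i) -/(s j); case: good_pair (adjP (s i) (s j)) => // ->.
Qed.

(** * Numerical estimates *)

(** The lower bound on d gives d <= 2 (d - 2^k), and 2 k 16^k <= 32^k because 2 k <= 2^k. *)
Lemma path_count_numeric (n k d : nat) :
  (0 < k)%N -> (2 ^ k.+1 <= d)%N ->
  ((d - 2 ^ k) ^ k <= n * (k * primorial (k + k)) ^ k)%N ->
  (d ^ k <= n * 32 ^ (k * k))%N.
Proof.
move=> k0 kd cnt; have d2 : (d <= 2 * (d - 2 ^ k))%N by move: kd; rewrite expnS; lia.
apply: leq_trans (_ : (2 * (d - 2 ^ k)) ^ k <= _)%N; first by rewrite leq_exp2r.
rewrite expnMn; apply: leq_trans (leq_mul (leqnn _) cnt) _.
rewrite mulnCA -expnMn leq_mul2l; apply/orP; right.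
rewrite expnM leq_exp2r // mulnA.
rewrite -[32%N]/(2 * 16)%N expnMn leq_mul //.
  case: k k0 {kd cnt d2} => // k _; elim: k => // k IHk; rewrite expnS; lia.
by apply: leq_trans (primorial_le _) _; rewrite addnn -mul2n expnM.
Qed.

Lemma expR4_ge32 (R : realType) : 32 <= expR 4 :> R.
Proof.
(* From exp(1/4) >= 5/4 one gets exp 4 >= (5/4)^16, which exceeds 32. *)
have -> : 4 = 16%:R * (1 / 4) :> R by lra.
rewrite expRM_natl; apply: le_trans (_ : (5 / 4) ^+ 16 <= _).
  by rewrite !exprS expr0; lra.
rewrite ler_pXn2r ?nnegrE ?expR_ge0 //.
by apply: le_trans (expR_ge1Dx _); lra.
Qed.

(** With k the integer part of x, the path count would give exp(6 x k) < exp(x^2 + 4 k^2), whereas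
    x^2 + 4 k^2 <= 6 x k for k <= x < k + 1 and k > 5. *)
Lemma degree_contradiction (R : realType) (n k d : nat) (x : R) :
  n%:R = expR (x ^+ 2) -> 6 < x -> k%:R <= x < k.+1%:R -> expR (6 * x) < d%:R ->
  ~ ((d - 2 ^ k) ^ k <= n * (k * primorial (k + k)) ^ k)%N.
Proof.
move=> nE x6 /andP[kx xk] dx cnt.
have k6 : 5 < k%:R :> R by move: xk; rewrite -natr1; lra.
have k0 : (0 < k)%N by rewrite -(ltr0n R); lra.
have kd : (2 ^ k.+1 <= d)%N.
  rewrite -(ler_nat R); apply: le_trans (ltW dx).
  apply: le_trans (_ : expR 1 ^+ k.+1 <= _).
    rewrite natrX ler_pXn2r ?nnegrE ?expR_ge0 //.
    by apply: le_trans (expR_ge1Dx _); lra.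
  by rewrite -expRM_natl ler_expR -natr1; lra.
have := path_count_numeric k0 kd cnt; apply/negP; rewrite -ltnNge -(ltr_nat R).
rewrite natrM !natrX nE; apply: le_lt_trans (_ : expR (6 * x) ^+ k < _); last first.
  by rewrite ltr_pXn2r ?nnegrE ?expR_ge0 // -lt0n.
apply: le_trans (_ : expR (x ^+ 2) * expR 4 ^+ (k * k) <= _).
  by rewrite ler_pM2l ?expR_gt0 // ler_pXn2r ?nnegrE ?expR_ge0 ?expR4_ge32 ?muln_gt0 ?k0 //.
rewrite -!expRM_natl -expRD ler_expR.
rewrite natrM; move: xk; rewrite -natr1; nra.
Qed.

(** * Assembling the bound *)

Theorem theorem1 (R : realType) (n : nat) (S : seq (R * R)) :
  (2 <= n)%N -> uniq S -> size S = n ->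
  (count_good_pairs S)%:R <=
    (n%:R : R) `^ (1 + 6 / Num.sqrt (ln (n%:R : R))).
Proof.
move=> n2 uS sS; set L := ln n%:R; set x := Num.sqrt L.
have n1 : 1 < n%:R :> R by rewrite ltr1n.
have n0 : 0 < n%:R :> R by rewrite (lt_trans _ n1).
have L0 : 0 < L by rewrite ln_gt0.
have x0 : 0 < x by rewrite sqrtr_gt0.
have xL : x ^+ 2 = L by rewrite sqr_sqrtr // ltW.
(* For x <= 6 the exponent 1 + 6 / x is at least 2, and there are at most n^2 index pairs. *)
have [x6|x6] := lerP x 6.
  apply: le_trans (_ : n%:R `^ 2%:R <= _).
    rewrite powR_mulrn ?(ltW n0) // -natrX ler_nat expnS expn1 -sS /count_good_pairs.
    rewrite -[X in (_ <= X * _)%N]card_ord -sum_nat_const; apply: leq_sum => i _.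
    rewrite big_mkcond -[X in (_ <= X)%N]card_ord -sum1_card; apply: leq_sum => j _.
    by case: ifP => // _; case: good_pair.
  by rewrite ler_powR ?(ltW n1) // -[2%:R]/(1 + 1) lerD2l ler_pdivlMr // mul1r.
have nE : n%:R = expR (x ^+ 2) by rewrite xL lnK.
have -> : n%:R `^ (1 + 6 / x) = n%:R * expR (6 * x).
  rewrite powRD ?(gt_eqF n0) ?implybT // powRr1 ?ltW // /powR (gt_eqF n0) -/L -xL.
  by congr (_ * expR _); field; rewrite gt_eqF.
pose adj (y z : R[i]) := `[< root_of_unity (z - y) >].
have adjP y z : adj y z -> root_of_unity (z - y) by move/asboolP.
have adj_sym : symmetric adj.
  move=> y z; apply/idP/idP => /adjP/root_of_unityN; rewrite opprB => ?; exact/asboolP.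
have adj_irr : irreflexive adj.
  by move=> y; apply/negP => /adjP/root_of_unity_neq0; rewrite subrr eqxx.
pose A := [seq Complex p.1 p.2 | p <- S].
have sA : size A = n by rewrite size_map.
have uA : uniq A by rewrite map_inj_uniq // => -[a b] [c d] /= [-> ->].
pose D := Num.truncn (expR (6 * x)).
have /andP[Dx xD] : D%:R <= expR (6 * x) < D.+1%:R by apply: truncn_itv; apply: expR_ge0.
have xk : (Num.truncn x)%:R <= x < (Num.truncn x).+1%:R by apply: truncn_itv; apply: ltW.
(* The factor 2 is kept because the degree sum counts each edge twice. *)
suff cnt : (2 * count_good_pairs S <= 2 * D * n)%N.
  rewrite -mulnA leq_pmul2l // in cnt.
  apply: le_trans (_ : (D * n)%:R <= _); first by rewrite ler_nat.
  by rewrite natrM mulrC ler_pM2l.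
apply: leq_trans (count_good_pairs_le S adj_sym _) _.
  by move=> p q /good_pair_root_of_unity ?; apply/asboolP.
rewrite -sA; apply: degree_sum_bound => // B uB BA nB.
have [/hasP[p pB pD]|/hasPn noB] := boolP (has (fun p => count (adj p) B <= D)%N B).
  by exists p.
(* Otherwise all degrees in [B] are at least [D.+1], which exceeds exp(6 x), while [B] has at most n
   points. *)
case: (degree_contradiction nE x6 xk xD).
apply: leq_trans (min_degree_bound _ adjP uB nB _) _; last first.
  by rewrite leq_mul2r -sA uniq_leq_size ?orbT.
by move=> p /noB; rewrite -ltnNge.
Qed.
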